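(* Let $a<b$ and $c<d$ be real numbers, let $\alpha_1,\alpha_2\in[a,b]$ with $\alpha_1<\alpha_2$ and $\beta_1,\beta_2\in[c,d]$ with $\beta_1<\beta_2$, and let $w:[a,b]\cup[c,d]\to[0,\infty)$ be integrable with $m(\alpha_1,\alpha_2)>0$ and $m(\beta_1,\beta_2)>0$, where $m(p,q)=\int_p^q w(u)\,du$. Let $f:[a,b]\times[c,d]\to\mathbb{R}$ be an absolutely continuous function such that the second order partial derivative $\frac{\partial^2 f(t,s)}{\partial t\,\partial s}$ exists for all $(t,s)\in[a,b]\times[c,d]$ and is bounded, i.e. $$\left\Vert \frac{\partial^2 f}{\partial t\,\partial s}\right\Vert_\infty=\sup_{(t,s)\in(a,b)\times(c,d)}\left|\frac{\partial^2 f(t,s)}{\partial t\,\partial s}\right|<\infty .$$ Then for all $(x,y)\in[a,b]\times[c,d]$, $$\left| f(x,y)-\left[\frac{1}{m(\alpha_1,\alpha_2)}\int_{\alpha_1}^{\alpha_2} w(t)f(t,y)\,dt+\frac{1}{m(\beta_1,\beta_2)}\int_{\beta_1}^{\beta_2} w(s)f(x,s)\,ds\right]\right.$$ $$\left.+\frac{1}{m(\alpha_1,\alpha_2)m(\beta_1,\beta_2)}\int_{\alpha_1}^{\alpha_2}\int_{\beta_1}^{\beta_2} w(t)w(s)f(t,s)\,ds\,dt\right|\le \frac{A_1(x)B_1(y)}{m(\alpha_1,\alpha_2)m(\beta_1,\beta_2)}\left\Vert \frac{\partial^2 f}{\partial t\,\partial s}\right\Vert_\infty ,$$ where $$A_1(x)=\int_{\alpha_1}^x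 (x-u)w(u)\,du+\int_x^{\alpha_2} (u-x)w(u)\,du,\qquad B_1(y)=\int_{\beta_1}^y (y-u)w(u)\,du+\int_y^{\beta_2} (u-y)w(u)\,du .$$
   Context: Absolute continuity of $f:[a,b]\times[c,d]\to\mathbb{R}$ is in the sense of Carathéodory: there are Lebesgue integrable functions $g$ on $[a,b]$, $h$ on $[c,d]$, $k$ on $[a,b]\times[c,d]$ with $f(x,y)=f(a,c)+\int_a^x g(t)\,dt+\int_c^y h(s)\,ds+\int_a^x\int_c^y k(t,s)\,ds\,dt$ for all $(x,y)\in[a,b]\times[c,d]$. Derivatives at boundary points are one-sided. Integrals are oriented: $\int_p^q=-\int_q^p$. *)

(* Defs.v *)
From HB Require Import structures.
From mathcomp Require Import all_boot all_order all_algebra.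
From mathcomp Require Import all_classical all_reals all_analysis.
Set Implicit Arguments.
Unset Strict Implicit.
Unset Printing Implicit Defensive.
Import Order.TTheory GRing.Theory Num.Theory.
Import numFieldNormedType.Exports.
Local Open Scope classical_set_scope.
Local Open Scope ring_scope.

(* [lebesgue_measure] only sees Borel sets.  The completed measures are used so
   that "Lebesgue integrable" covers all Lebesgue-measurable functions. *)
Notation leb1 := completed_lebesgue_measure.

Definition leb2 (R : realType) :=
  @completed_measure_extension _ _ _
    (@lebesgue_measure R \x @lebesgue_measure R)%E.

Definition lebesgue_integrable (R : realType) (D : set R) (g : R -> R) : Prop :=
  (@leb1 R).-integrable D (EFin \o g).

Definition lebesgue_integrable2 (R : realType) (D : set (R * R))
    (k : R -> R -> R) : Prop :=
  (@leb2 R).-integrable D (EFin \o (fun z : R * R => k z.1 z.2)).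

Definition oriented_integral (R : realType) (p q : R) (g : R -> R) : R :=
  if p <= q then \int[@leb1 R]_(u in `[p, q]) g u
  else - \int[@leb1 R]_(u in `[q, p]) g u.

Notation "\oint[ p , q ]_ u e" := (oriented_integral p q (fun u => e))
  (at level 36, e at level 36, u at level 0, p, q at level 50,
   format "\oint[ p ,  q ]_ u  e") : ring_scope.

(* Absolute continuity on the rectangle in the sense of Carathéodory. *)
Definition caratheodory_ac (R : realType) (a b c d : R) (f : R -> R -> R) :
    Prop :=
  exists (g h : R -> R) (k : R -> R -> R),
    [/\ lebesgue_integrable `[a, b] g,
        lebesgue_integrable `[c, d] h,
        lebesgue_integrable2 (`[a, b] `*` `[c, d]) k &
        forall x y, x \in `[a, b] -> y \in `[c, d] ->
          f x y = f a c + (\oint[a, x]_t g t) + (\oint[c, y]_s h s)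
                  + (\oint[a, x]_t \oint[c, y]_s k t s)].

(* Derivative of [g] at [x] relative to [D]: the usual derivative when [x] is
   interior to [D], the one-sided one at an end point of an interval [D]. *)
Definition derivable_within (R : realType) (D : set R) (g : R -> R) (x : R) :
    Prop :=
  cvg ((fun u => (g u - g x) / (u - x)) @ within D x^').

Definition derive_within (R : realType) (D : set R) (g : R -> R) (x : R) : R :=
  lim ((fun u => (g u - g x) / (u - x)) @ within D x^').

(* The differentiation with respect to the second variable [s] is carried out
   first: d^2 f / dt ds = d/dt (df/ds). *)
Definition mixed_derivable (R : realType) (a b c d : R) (f : R -> R -> R)
    (t s : R) : Prop :=
  derivable_within `[c, d] (f t) s /\
  derivable_within `[a, b] (fun t' => derive_within `[c, d] (f t') s) t.

Definition mixed_derive (R : realType) (a b c d : R) (f : R -> R -> R)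
    (t s : R) : R :=
  derive_within `[a, b] (fun t' => derive_within `[c, d] (f t') s) t.

Definition mixed_sup_norm (R : realType) (a b c d : R) (f : R -> R -> R) :
    \bar R :=
  ereal_sup [set (`|mixed_derive a b c d f z.1 z.2|)%:E |
              z in `]a, b[ `*` `]c, d[].

Definition mass (R : realType) (w : R -> R) (p q : R) : R :=
  \oint[p, q]_u w u.

(* With oriented integrals, this is not \int_p^q |x - u| w(u) du when [x] lies
   outside of [p, q]. *)
Definition moment (R : realType) (w : R -> R) (p q x : R) : R :=
  (\oint[p, x]_u ((x - u) * w u)) + (\oint[x, q]_u ((u - x) * w u)).

(* Main.v *)
(* Put D(t, s) = f(x, y) - f(t, y) - f(x, s) + f(t, s) and let M be the sup norm
   of the mixed derivative.  The mean value theorem, first in s and then in t,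
   gives |D(t, s)| <= M |x - t| |y - s|.  The left-hand side of the theorem is
   the iterated integral of w(t) w(s) D(t, s) divided by the two masses, and
   \int_p^q |x - u| w(u) du is at most the oriented moment.
   Absolute continuity serves only for integrability: it makes f measurable and
   bounded on the edges s = c and t = a, and by the bound on cross differences f
   is, up to its values on an edge, Lipschitz in each variable.  As the double
   integral is iterated, Fubini's theorem is not needed. *)

Require Import Defs.
From HB Require Import structures.
From mathcomp Require Import all_boot all_order all_algebra.
From mathcomp Require Import all_classical all_reals all_analysis.
From mathcomp Require Import measurable_realfun ring.
Import Order.TTheory GRing.Theory Num.Theory.
Import numFieldNormedType.Exports.
Local Open Scope classical_set_scope.
Local Open Scope ring_scope.

Set Implicit Arguments.
Unset Strict Implicit.
Unset Printing Implicit Defensive.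

(** * Derivatives relative to an interval and the bound on cross differences *)

Section derivatives_within.
Context (R : realType).
Implicit Types (D : set R) (g dg : R -> R).

Lemma within_dnbhsP D (x : R) (P : set R) :
  (\forall u \near within D x^', P u) <->
  (\forall u \near x, u != x -> D u -> P u).
Proof. by []. Qed.

(** Near x, [g u] equals [g x] plus the slope times [u - x]; the slope converges and [u - x] tends
    to 0. The slope only sees the punctured neighbourhood, so the point u = x is put back separately
    at the end. *)
Lemma continuous_slope_within D g dg :
  (forall x, D x -> (g u - g x) / (u - x) @[u --> within D x^'] --> dg x) ->
  {within D, continuous g}.
Proof.
move=> gdg; apply/subspace_continuousP => x Dx.
have gl : g u @[u --> within D x^'] --> g x.
  have -> : g x = g x + dg x * (x - x) by rewrite subrr mulr0 addr0.
  have cu : u @[u --> within D x^'] --> x.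
    by apply: cvg_trans; [exact: cvg_within|exact: nbhs_dnbhs].
  apply: (@cvg_trans _ ((g x + (g u - g x) / (u - x) * (u - x))
      @[u --> within D x^'])); last first.
    apply: cvgD; first exact: cvg_cst.
    apply: cvgM; first exact: gdg.
    by apply: cvgB => //; exact: cvg_cst.
  apply: near_eq_cvg; apply/within_dnbhsP; near=> u => ux Du.
  by rewrite divfK ?subr_eq0// addrC subrK.
apply/cvgrPdist_lt => e e0.
move/cvgrPdist_lt : gl => /(_ e e0) /within_dnbhsP H.
apply: filterS H => u H Du.
by have [->|ux] := eqVneq u x; [rewrite subrr normr0|exact: H].
Unshelve. all: by end_near. Qed.

(** At an interior point the restriction to [D] is eventually vacuous, and the shift u = h + x turns
    the slope into the difference quotient behind [is_derive]. *)
Lemma is_derive_slope_within D g (x l : R) : D° x ->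
  (g u - g x) / (u - x) @[u --> within D x^'] --> l -> is_derive x 1 g l.
Proof.
move=> Dx gl.
have H : (h^-1 *: (g (h *: 1 + x) - g x)) @[h --> 0^'] --> l.
  apply/cvgrPdist_lt => e e0.
  move/cvgrPdist_lt : gl => /(_ e e0) /within_dnbhsP H.
  have {}H : \forall u \near x, u != x -> `|l - (g u - g x) / (u - x)| < e.
    by apply: filterS2 Dx H => u Du H /H; exact.
  have shift0 : (h *: 1 + x) @[h --> (0:R)] --> x.
    rewrite -[X in _ --> X]add0r; apply: cvgD; last exact: cvg_cst.
    by rewrite -[X in _ --> X](scale0r 1); apply: cvgZr_tmp.
  suff : \forall h \near (0:R), h != 0 ->
      `|l - h^-1 *: (g (h *: 1 + x) - g x)| < e by [].
  near=> h; have : h *: 1 + x != x -> `|l - (g (h *: 1 + x) - g x) / (h *: 1 + x - x)| < e.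
    by near: h; exact: shift0 _ H.
  rewrite /GRing.scale/= mulr1 -[X in _ != X]add0r (inj_eq (addIr x)) => Hh h0.
  by rewrite mulrC -[X in _ / X](addrK x); exact: Hh.
split; first by apply/cvg_ex; eexists; exact: H.
exact: cvg_lim H.
Unshelve. all: by end_near. Qed.

(** Points of the open interval from u to v are interior to [a, b], so the usual mean value theorem
    applies there; the ends only require continuity. The witness is placed in the open interval ]a,
    b[ because the sup norm ranges over the open rectangle. *)
Lemma MVT_within (a b u v : R) g dg : a <= u -> u < v -> v <= b ->
  (forall x, x \in `[a, b] ->
    (g u - g x) / (u - x) @[u --> within `[a, b] x^'] --> dg x) ->
  exists2 z, z \in `]a, b[ & g v - g u = dg z * (v - u).
Proof.
move=> au uv vb gdg.
have [||z zuv ->] := @MVT R g dg u v uv.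
- move=> x; rewrite in_itv/= => /andP[ux xv].
  apply: (@is_derive_slope_within `[a, b]).
  + by rewrite interior_itv/= in_itv/= (le_lt_trans au)//= (lt_le_trans xv).
  + by apply: gdg; rewrite /= in_itv/= (le_trans au (ltW ux))//= (le_trans (ltW xv)).
- apply: (@continuous_subspaceW _ _ _ `[a, b]).
    by apply: subset_itvScc; rewrite bnd_simp.
  exact: continuous_slope_within gdg.
- exists z => //; move: zuv; rewrite !in_itv/= => /andP[uz zv].
  by rewrite (le_lt_trans au)//= (lt_le_trans zv).
Qed.

(** Two mean value theorems, one per variable, write the cross difference as the mixed derivative at
    an interior point times the area of the rectangle spanned by (t, s) and (x, y). *)
Lemma cross_difference_le (a b c d M : R) (f : R -> R -> R) :
  (forall t s, t \in `[a, b] -> s \in `[c, d] -> mixed_derivable a b c d f t s) ->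
  (forall t s, t \in `]a, b[ -> s \in `]c, d[ ->
    `|mixed_derive a b c d f t s| <= M) ->
  forall x t y s, x \in `[a, b] -> t \in `[a, b] ->
    y \in `[c, d] -> s \in `[c, d] ->
  `|f x y - f t y - f x s + f t s| <= M * (`|x - t| * `|y - s|).
Proof.
move=> df fM.
have key x t y s : x \in `[a, b] -> t \in `[a, b] -> y \in `[c, d] ->
    s \in `[c, d] -> t < x -> s < y ->
    `|f x y - f t y - f x s + f t s| <= M * (`|x - t| * `|y - s|).
  move=> xab tab ycd scd tx sy.
  move: (xab) (tab) (ycd) (scd); rewrite !in_itv/=.
  move=> /andP[_ xb] /andP[ta _] /andP[_ yd] /andP[cs _].
  (* First in the second variable: the cross difference is the increment of [f x r - f t r] as r
     goes from s to y. *)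
  have [r rcd|r rcd E] := @MVT_within c d s y (fun r => f x r - f t r)
    (fun r => derive_within `[c, d] (f x) r - derive_within `[c, d] (f t) r)
    cs sy yd.
    have -> : (fun u => (f x u - f t u - (f x r - f t r)) / (u - r)) =
      (fun u => (f x u - f x r) / (u - r) - (f t u - f t r) / (u - r)).
      by apply/funext => u; rewrite -mulrBl; congr (_ / _); ring.
    apply: cvgB; first by have [] := df x r xab rcd.
    by have [] := df t r tab rcd.
  have rcd' : r \in `[c, d] by apply: subset_itv_oo_cc.
  (* Then in the first variable, at the height r just found. As r is interior to [c, d] and q to
     [a, b], the bound [M] is available at (q, r). *)
  have [q qab|q qab] := @MVT_within a b t x
    (fun t => derive_within `[c, d] (f t) r)
    (fun t => mixed_derive a b c d f t r) ta tx xb.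
    by have [] := df q r qab rcd'.
  move=> F; move: E; rewrite F => E.
  have -> : f x y - f t y - f x s + f t s =
      mixed_derive a b c d f q r * ((x - t) * (y - s)).
    by rewrite mulrA -E; ring.
  by rewrite !normrM ler_wpM2r ?mulr_ge0//; exact: fM.
move=> x t y s xab tab ycd scd.
(* Exchanging x with t, or y with s, only changes the sign of the cross difference, and it vanishes
   when x = t or y = s; so the ordered case [key] suffices. *)
have [tx|xt|->] := ltgtP t x; last by
  rewrite !subrr normr0 mul0r mulr0 sub0r addNr normr0.
- have [sy|ys|->] := ltgtP s y; last by
    rewrite subrr normr0 !mulr0 [_ - f t y]addrC addrK addNr normr0.
  + exact: key.
  + rewrite -normrN (distrC y); apply: le_trans (key _ _ _ _ xab tab scd ycd tx ys).
    by rewrite le_eqVlt; apply/orP; left; apply/eqP; congr `| _ |; ring.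
- have [sy|ys|->] := ltgtP s y; last by
    rewrite subrr normr0 !mulr0 [_ - f t y]addrC addrK addNr normr0.
  + rewrite -normrN (distrC x); apply: le_trans (key _ _ _ _ tab xab ycd scd xt sy).
    by rewrite le_eqVlt; apply/orP; left; apply/eqP; congr `| _ |; ring.
  + rewrite (distrC y) (distrC x).
    apply: le_trans (key _ _ _ _ tab xab scd ycd xt ys).
    by rewrite le_eqVlt; apply/orP; left; apply/eqP; congr `| _ |; ring.
Qed.

End derivatives_within.

(** * Bounded measurable functions and integrals against an integrable weight *)

Section bounded_measurable.
Context d (T : measurableType d) (R : realType).
Implicit Types (A B C D : set T) (g h w : T -> R).

(** This class is stable under linear combinations, and its members remain integrable after
    multiplication by an integrable weight. It thus carries all integrability side conditions
    below. *)
Definition bounded_measurable D g :=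
  measurable_fun D g /\ exists C : R, forall x, D x -> `|g x| <= C.

Lemma bounded_measurable_cst D (r : R) : bounded_measurable D (fun=> r).
Proof. by split; [exact: measurable_cst|exists `|r|]. Qed.

Lemma bounded_measurableD D g h : bounded_measurable D g ->
  bounded_measurable D h -> bounded_measurable D (fun x => g x + h x).
Proof.
move=> [mg [C gC]] [mh [C' hC']]; split; first exact: measurable_funD.
exists (C + C') => x Dx; apply: le_trans (ler_normD _ _) _.
by apply: lerD; [exact: gC|exact: hC'].
Qed.

Lemma bounded_measurableZ D (r : R) g : bounded_measurable D g ->
  bounded_measurable D (fun x => r * g x).
Proof.
move=> [mg [C gC]]; split; first by apply: measurable_funM => //; exact: measurable_cst.
by exists (`|r| * C) => x Dx; rewrite normrM ler_wpM2l//; exact: gC.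
Qed.

Lemma bounded_measurableB D g h : bounded_measurable D g ->
  bounded_measurable D h -> bounded_measurable D (fun x => g x - h x).
Proof.
move=> bg /(bounded_measurableZ (-1)) /(bounded_measurableD bg).
by under eq_fun do rewrite mulN1r.
Qed.

Lemma bounded_measurableS D D' g : measurable D -> D' `<=` D ->
  bounded_measurable D g -> bounded_measurable D' g.
Proof.
move=> mD DD' [mg [C gC]]; split; first exact: measurable_funS mg.
by exists C => x /DD'; exact: gC.
Qed.

Lemma eq_bounded_measurable D g h : (forall x, D x -> g x = h x) ->
  bounded_measurable D g -> bounded_measurable D h.
Proof.
move=> gh [mg [C gC]]; split; last by exists C => x Dx; rewrite -gh//; exact: gC.
by apply: eq_measurable_fun mg => x /[1!inE] /gh.
Qed.

Variable mu : {measure set T -> \bar R}.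

Lemma integrable_weighted D w g : measurable D ->
  mu.-integrable D (EFin \o w) -> bounded_measurable D g ->
  mu.-integrable D (EFin \o (fun x => w x * g x)).
Proof.
move=> mD iw [mg [C gC]].
have := @integrableMl _ _ _ mu D mD (EFin \o w) g iw mg.
rewrite (_ : (_ \* _)%E = EFin \o (fun x => w x * g x)); last first.
  by apply/funext => x /=; rewrite EFinM.
apply; exists C; split; first exact: num_real.
by move=> C' CC' x Dx /=; rewrite (le_trans (gC x Dx)) ?ltW.
Qed.

Lemma weighted_RintegralZ D w g (r : R) : measurable D ->
  mu.-integrable D (EFin \o w) -> bounded_measurable D g ->
  \int[mu]_(x in D) (w x * (r * g x)) = r * \int[mu]_(x in D) (w x * g x).
Proof.
move=> mD iw bg; under eq_Rintegral do rewrite mulrCA.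
by rewrite RintegralZl//; exact: integrable_weighted.
Qed.

Lemma le_weighted_Rintegral D w g h : measurable D ->
  mu.-integrable D (EFin \o w) -> (forall x, D x -> 0 <= w x) ->
  bounded_measurable D g -> bounded_measurable D h ->
  (forall x, D x -> `|g x| <= h x) ->
  `|\int[mu]_(x in D) (w x * g x)| <= \int[mu]_(x in D) (w x * h x).
Proof.
move=> mD iw w0 bg bh gh.
apply: le_trans (le_normr_Rintegral _ _) _ => //; first exact: integrable_weighted.
apply: le_Rintegral => //.
- apply: (@integrable_norm _ _ _ _ _ (fun x => w x * g x)).
  exact: integrable_weighted.
- exact: integrable_weighted.
- by move=> x Dx; rewrite normrM ger0_norm ?w0// ler_wpM2l ?w0//; exact: gh.
Qed.

Lemma ge0_subset_Rintegral A B h : measurable A -> measurable B ->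
  mu.-integrable B (EFin \o h) -> (forall x, B x -> 0 <= h x) -> A `<=` B ->
  \int[mu]_(x in A) h x <= \int[mu]_(x in B) h x.
Proof.
move=> mA mB ih h0 AB; apply: fine_le.
- by apply: integrable_fin_num => //; exact: integrableS ih.
- exact: integrable_fin_num.
- apply: ge0_subset_integral => //; exact: measurable_int ih.
Qed.

(** [B] and [C] may overlap: the union is split into [B] and [C] minus [B], and nonnegativity bounds
    the integral over the latter by the one over [C]. *)
Lemma ge0_Rintegral_setU_le A B C h :
  measurable A -> measurable B -> measurable C ->
  mu.-integrable (B `|` C) (EFin \o h) ->
  (forall x, (B `|` C) x -> 0 <= h x) -> A `<=` B `|` C ->
  \int[mu]_(x in A) h x <= \int[mu]_(x in B) h x + \int[mu]_(x in C) h x.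
Proof.
move=> mA mB mC ih h0 ABC; have mBC := measurableU _ _ mB mC.
apply: (le_trans (ge0_subset_Rintegral mA mBC ih h0 ABC)).
have mCB := measurableD mC mB.
have E : B `|` C = B `|` (C `\` B) by rewrite setUDr setDv setD0.
rewrite E Rintegral_setU//; last 2 first.
- by rewrite -E.
- by apply/disj_setPS => x [Bx [_ nBx]].
rewrite lerD2l ge0_subset_Rintegral//.
- by apply: integrableS ih => //; exact: subsetUr.
- by move=> x Cx; apply: h0; right.
Qed.

End bounded_measurable.

(** * Iterated integration of the cross-difference bound *)

Section weighted_cross_difference.
Context d1 (T1 : measurableType d1) d2 (T2 : measurableType d2) (R : realType).
Variables (mu1 : {measure set T1 -> \bar R}) (mu2 : {measure set T2 -> \bar R}).

(** The left-hand side is the iterated integral of the weighted expression [v - p t - q s + f t s],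
    so the pointwise bound is integrated in s and then in t. In the application [v] is f(x, y), [p]
    and [q] are the sections of f through (x, y), and [r1], [r2] are the distances to x and y.
    Multiplying through by both masses avoids division. *)
Lemma weighted_cross_difference_le (I1 : set T1) (I2 : set T2)
    (w1 p r1 : T1 -> R) (w2 q r2 : T2 -> R) (f : T1 -> T2 -> R) (v M : R)
    (m1 := \int[mu1]_(t in I1) w1 t) (m2 := \int[mu2]_(s in I2) w2 s) :
  measurable I1 -> measurable I2 ->
  mu1.-integrable I1 (EFin \o w1) -> mu2.-integrable I2 (EFin \o w2) ->
  (forall t, I1 t -> 0 <= w1 t) -> (forall s, I2 s -> 0 <= w2 s) ->
  bounded_measurable I1 p -> bounded_measurable I1 r1 ->
  bounded_measurable I2 q -> bounded_measurable I2 r2 ->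
  (forall t, I1 t -> bounded_measurable I2 (f t)) ->
  bounded_measurable I1 (fun t => \int[mu2]_(s in I2) (w2 s * f t s)) ->
  (forall t s, I1 t -> I2 s -> `|v - p t - q s + f t s| <= M * (r1 t * r2 s)) ->
  `|m1 * m2 * v - m2 * \int[mu1]_(t in I1) (w1 t * p t)
      - m1 * \int[mu2]_(s in I2) (w2 s * q s)
      + \int[mu1]_(t in I1) (w1 t * \int[mu2]_(s in I2) (w2 s * f t s))|
  <= M * ((\int[mu1]_(t in I1) (w1 t * r1 t)) *
          (\int[mu2]_(s in I2) (w2 s * r2 s))).
Proof.
move=> mI1 mI2 iw1 iw2 w10 w20 bp br1 bq br2 bf bF fM.
set F := fun t => \int[mu2]_(s in I2) (w2 s * f t s) in bF *.
set Q := \int[mu2]_(s in I2) (w2 s * q s).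
set R1 := \int[mu1]_(t in I1) (w1 t * r1 t).
set R2 := \int[mu2]_(s in I2) (w2 s * r2 s).
(* The inner integral of the weighted cross difference, in expanded form: boundedness and
   measurability in t can be read off here, while [GE] recovers the integral form needed for the
   estimate. *)
pose G t := m2 * v - m2 * p t - Q + F t.
have bc1 (r : R) := bounded_measurable_cst I1 r.
have bc2 (r : R) := bounded_measurable_cst I2 r.
have GE t : I1 t -> G t = \int[mu2]_(s in I2) (w2 s * (v - p t - q s + f t s)).
  move=> It; have bft := bf t It.
  have iq := integrable_weighted mI2 iw2 bq.
  have if_ := integrable_weighted mI2 iw2 bft.
  have ic := integrable_weighted mI2 iw2 (bc2 (v - p t)).
  have icq : mu2.-integrable I2 (EFin \o (fun s => w2 s * (v - p t) - w2 s * q s)).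
    under eq_fun do rewrite -mulrBr.
    by apply: integrable_weighted => //; exact: bounded_measurableB.
  under eq_Rintegral do rewrite mulrDr mulrBr.
  rewrite RintegralD// RintegralB// RintegralZr//.
  by rewrite /G /Q /F -/m2; ring.
have bG : bounded_measurable I1 G.
  apply: bounded_measurableD => //; apply: bounded_measurableB => //.
  by apply: bounded_measurableB => //; exact: bounded_measurableZ.
have -> : m1 * m2 * v - m2 * \int[mu1]_(t in I1) (w1 t * p t) - m1 * Q +
    \int[mu1]_(t in I1) (w1 t * F t) = \int[mu1]_(t in I1) (w1 t * G t).
  have ip := integrable_weighted mI1 iw1 (bounded_measurableZ m2 bp).
  have iF := integrable_weighted mI1 iw1 bF.
  have icp : mu1.-integrable I1 (EFin \o (fun t => w1 t * (m2 * v - Q)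
      - w1 t * (m2 * p t))).
    under eq_fun do rewrite -mulrBr.
    apply: integrable_weighted => //; apply: bounded_measurableB => //.
    exact: bounded_measurableZ.
  transitivity (\int[mu1]_(t in I1)
      (w1 t * (m2 * v - Q) - w1 t * (m2 * p t) + w1 t * F t)).
    rewrite RintegralD// RintegralB//; last exact: integrable_weighted.
    rewrite RintegralZr//.
    by rewrite weighted_RintegralZ// -/m1; ring.
  by apply: eq_Rintegral => t _; rewrite /G; ring.
(* The bound of [G t] by [M * R2 * r1 t] is the same estimate one level down, [R2] being the
   integral of [w2 s * r2 s]. *)
apply: le_trans (@le_weighted_Rintegral _ _ _ mu1 I1 w1 G
    (fun t => M * R2 * r1 t) mI1 iw1 w10 bG _ _) _.
- exact: bounded_measurableZ.
- move=> t It; rewrite GE//.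
  apply: le_trans (@le_weighted_Rintegral _ _ _ mu2 I2 w2 _
    (fun s => M * r1 t * r2 s) mI2 iw2 w20 _ _ _) _.
  + apply: bounded_measurableD; last exact: bf.
    exact: bounded_measurableB.
  + exact: bounded_measurableZ.
  + by move=> s Is; rewrite -mulrA; exact: fM.
  + by rewrite weighted_RintegralZ// -/R2 mulrAC.
- by rewrite weighted_RintegralZ// -mulrA [R2 * _]mulrC.
Qed.

End weighted_cross_difference.

(* The carrier of [leb1]: R with its Lebesgue-measurable sets. *)
Local Notation lebR R := (caratheodory_type (wlength (@idfun R))^*%mu).

(** * Measurability and moments for the completed Lebesgue measure on an interval *)

Section completed_lebesgue.
Context (R : realType).
Implicit Types (a b p q x : R) (g h w : R -> R).

Lemma measurable_lebR (A : set R) :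
  measurable (A : set (measurableTypeR R)) -> measurable (A : set (lebR R)).
Proof. exact: sub_caratheodory. Qed.

Lemma leb1E (A : set R) : @leb1 R A = lebesgue_measure A.
Proof. by []. Qed.

Lemma measurable_itv_lebR (i : interval R) : measurable ([set` i] : set (lebR R)).
Proof. by apply: measurable_lebR; exact: measurable_itv. Qed.
Hint Resolve measurable_itv_lebR : core.

Lemma measurable_fun_lebR (D : set R) g :
  measurable (D : set (measurableTypeR R)) ->
  measurable_fun (D : set (measurableTypeR R)) g ->
  measurable_fun (D : set (lebR R)) g.
Proof. by move=> mD mg _ Y mY; apply: measurable_lebR; exact: mg. Qed.

(** Continuity on the interval gives Borel measurability, and comparison with the value at a gives
    the bound. The sign of [C] is left open, hence the absolute values in the proof. *)
Lemma lipschitz_bounded_measurable a b g (C : R) :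
  (forall t t', t \in `[a, b] -> t' \in `[a, b] -> `|g t - g t'| <= C * `|t - t'|) ->
  bounded_measurable (`[a, b] : set (lebR R)) g.
Proof.
move=> gC; split.
  apply: measurable_fun_lebR; first exact: measurable_itv.
  apply: subspace_continuous_measurable_fun; first exact: measurable_itv.
  apply/subspace_continuousP => x xab; apply/cvgrPdist_le => e e0.
  rewrite near_withinE; near=> t => tab.
  apply: le_trans (gC _ _ xab tab) _.
  (* The added 1 makes the constant positive, so that e can be divided by it. *)
  have C0 : 0 < `|C| + 1 by rewrite ltr_wpDl.
  apply: (@le_trans _ _ ((`|C| + 1) * `|x - t|)).
    by rewrite ler_wpM2r// (le_trans (ler_norm _))// lerDl.
  rewrite mulrC -ler_pdivlMr//; near: t.
  by apply: cvgr_dist_le; [exact: cvg_id|rewrite divr_gt0].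
exists (`|g a| + `|C| * (b - a)) => x xab.
have [ax xb] : a <= x /\ x <= b by apply/andP; move: xab; rewrite /= in_itv.
rewrite -[g x](subrK (g a)) addrC; apply: le_trans (ler_normD _ _) _.
rewrite lerD2l; apply: le_trans (gC _ _ xab _) _.
  by rewrite in_itv/= lexx (le_trans ax).
rewrite ger0_norm ?subr_ge0// (le_trans (ler_wpM2r _ (ler_norm C))) ?subr_ge0//.
by rewrite ler_wpM2l// lerD2r.
Unshelve. all: by end_near. Qed.

Lemma bounded_measurable_dist a b x :
  bounded_measurable (`[a, b] : set (lebR R)) (fun u => `|x - u|).
Proof.
apply: (@lipschitz_bounded_measurable _ _ _ 1) => t t' _ _; rewrite mul1r.
apply: le_trans (ler_dist_dist _ _) _.
by rewrite (_ : x - t - (x - t') = t' - t) 1?distrC//; ring.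
Qed.

(** Write g as the difference of the nonnegative functions |g| + g and |g|. Their indefinite
    integrals are nondecreasing, hence measurable, and are bounded by the integrals over [a, b]. *)
Lemma bounded_measurable_indefinite a b g : lebesgue_integrable `[a, b] g ->
  bounded_measurable (`[a, b] : set (lebR R)) (fun x => \oint[a, x]_u g u).
Proof.
move=> ig.
(* Truncating at b with [Num.min x b] makes the indefinite integral monotone on the whole line, as
   [nondecreasing_measurable] requires, and keeps the domain inside [a, b]. *)
have mono h : lebesgue_integrable `[a, b] h ->
    (forall u, u \in `[a, b] -> 0 <= h u) ->
    bounded_measurable (`[a, b] : set (lebR R))
      (fun x => \int[@leb1 R]_(u in `[a, Num.min x b]) h u).
  move=> ih h0.
  have sub x : `[a, Num.min x b] `<=` `[a, b].
    by apply: subset_itvScc; rewrite bnd_simp// ge_min lexx orbT.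
  split; last first.
    exists (\int[@leb1 R]_(u in `[a, b]) h u) => x _.
    rewrite ger0_norm; last by apply: Rintegral_ge0 => u /sub /h0.
    exact: ge0_subset_Rintegral.
  apply: measurable_fun_lebR; first exact: measurable_itv.
  apply: nondecreasing_measurable; first exact: measurable_itv.
  move=> x y xy; apply: ge0_subset_Rintegral => //.
  - exact: integrableS ih.
  - by move=> u /sub /h0.
  - apply: subset_itvScc; rewrite bnd_simp//.
    by rewrite le_min ge_min xy/= ge_min lexx orbT.
have ing : lebesgue_integrable `[a, b] (fun u => `|g u|).
  exact: (integrable_norm ig).
have igg : lebesgue_integrable `[a, b] (fun u => `|g u| + g u).
  rewrite /lebesgue_integrable (_ : _ \o _ =
    (fun u => (`|g u|)%:E + (g u)%:E)%E); last exact/funext.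
  exact: integrableD.
apply: eq_bounded_measurable (bounded_measurableB (mono _ igg _) (mono _ ing _)).
- move=> x /=; rewrite in_itv/= => /andP[ax xb].
  rewrite min_l// /oriented_integral ax.
  have sub : `[a, x] `<=` `[a, b] by apply: subset_itvScc; rewrite bnd_simp.
  rewrite -RintegralB//.
  + by apply: eq_Rintegral => u _; ring.
  + exact: integrableS igg.
  + exact: integrableS ing.
- by move=> u _; rewrite -lerBlDr sub0r -normrN ler_norm.
- by [].
Qed.

Lemma oriented_integral_itv1 p g : \oint[p, p]_u g u = 0.
Proof.
rewrite /oriented_integral lexx set_itv1.
transitivity (\int[@leb1 R]_(u in [set p]) g p).
  by apply: eq_Rintegral => u; rewrite inE => ->.
rewrite Rintegral_cst; last by rewrite -set_itv1; exact: measurable_itv_lebR.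
by rewrite [X in fine X]leb1E lebesgue_measure_set1 mulr0.
Qed.

(** When an orientation is reversed, its minus sign also turns the integrand into [w u] times |x -
    u|. The moment is therefore a sum of integrals of this nonnegative function over the interval
    between p and x and the one between x and q, which together cover [p, q]. *)
Lemma le_moment a b w p q x : lebesgue_integrable `[a, b] w ->
  (forall u, u \in `[a, b] -> 0 <= w u) ->
  p \in `[a, b] -> q \in `[a, b] -> x \in `[a, b] ->
  \int[@leb1 R]_(u in `[p, q]) (w u * `|x - u|) <= moment w p q x.
Proof.
move=> iw w0 pab qab xab.
have iwx : lebesgue_integrable `[a, b] (fun u => w u * `|x - u|).
  exact: (integrable_weighted (measurable_itv_lebR _) iw
    (bounded_measurable_dist _ _ _)).
have sub r s : r \in `[a, b] -> s \in `[a, b] -> `[r, s] `<=` `[a, b].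
  rewrite !in_itv/= => /andP[ar _] /andP[_ sb].
  by apply: subset_itvScc; rewrite bnd_simp.
have int_neg (D : set R) g h : measurable (D : set (lebR R)) ->
    lebesgue_integrable D h -> (forall u, D u -> g u = - h u) ->
    - (\int[@leb1 R]_(u in D) g u) = \int[@leb1 R]_(u in D) h u.
  move=> mD ih gh; apply/eqP; rewrite eqr_oppLR -mulN1r -RintegralZl//.
  by apply/eqP; apply: eq_Rintegral => u /[1!inE] /gh ->; rewrite mulN1r.
have -> : moment w p q x =
    \int[@leb1 R]_(u in `[Num.min p x, Num.max p x]) (w u * `|x - u|) +
    \int[@leb1 R]_(u in `[Num.min x q, Num.max x q]) (w u * `|x - u|).
  rewrite /moment /oriented_integral; congr (_ + _).
  - case: (leP p x) => px.
      apply: eq_Rintegral => u; rewrite inE/= in_itv/= => /andP[_ ux].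
      by rewrite ger0_norm ?subr_ge0// mulrC.
    apply: int_neg => //; first by apply: integrableS iwx => //; exact: sub.
    move=> u; rewrite /= in_itv/= => /andP[xu _].
    by rewrite ler0_norm ?subr_le0//; ring.
  - case: (leP x q) => xq.
      apply: eq_Rintegral => u; rewrite inE/= in_itv/= => /andP[xu _].
      by rewrite ler0_norm ?subr_le0// opprB mulrC.
    apply: int_neg => //; first by apply: integrableS iwx => //; exact: sub.
    move=> u; rewrite /= in_itv/= => /andP[_ ux].
    by rewrite ger0_norm ?subr_ge0//; ring.
have sub1 : `[Num.min p x, Num.max p x] `|` `[Num.min x q, Num.max x q]
    `<=` `[a, b].
  by rewrite subUset; split; apply: sub; rewrite /Order.min /Order.max; case: ifP.
apply: ge0_Rintegral_setU_le => //.
- by apply: integrableS iwx => //; exact: measurableU.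
- by move=> u /sub1 uab; rewrite mulr_ge0// w0.
- move=> u /=; rewrite !in_itv/= !ge_min !le_max => /andP[pu uq].
  by case: (leP u x) => [_|/ltW xu]; [left; rewrite pu orbT|right; rewrite xu uq orbT].
Qed.

End completed_lebesgue.

#[local] Hint Resolve measurable_itv_lebR : core.

(** * Oriented integrals and the values of f on two edges *)

Lemma oriented_integralE (R : realType) (p q : R) (g : R -> R) : p <= q ->
  \oint[p, q]_u g u = \int[@leb1 R]_(u in `[p, q]) g u.
Proof. by rewrite /oriented_integral => ->. Qed.

Lemma oriented_integral0 (R : realType) (p q : R) : \oint[p, q]_u 0 = 0 :> R.
Proof.
by rewrite /oriented_integral; case: ifP => _; rewrite Rintegral_cst// mul0r ?oppr0.
Qed.

(** On the edge y = c the integrals of h and k vanish, which leaves a constant plus an indefinite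
    integral of g; on the edge x = a only the integral of h survives. *)
Lemma caratheodory_ac_edges (R : realType) (a b c d : R) (f : R -> R -> R) :
  a <= b -> c <= d -> caratheodory_ac a b c d f ->
  bounded_measurable (`[a, b] : set (lebR R)) (f^~ c) /\
  bounded_measurable (`[c, d] : set (lebR R)) (f a).
Proof.
move=> ab cd [g [h [k [ig ih _ fE]]]].
have aab : a \in `[a, b] by rewrite in_itv/= lexx.
have ccd : c \in `[c, d] by rewrite in_itv/= lexx.
split.
- apply: eq_bounded_measurable (bounded_measurableD
    (bounded_measurable_cst _ (f a c)) (bounded_measurable_indefinite ig)).
  move=> t tab; rewrite [RHS]fE// oriented_integral_itv1 addr0.
  have -> : (fun r => \oint[c, c]_s k r s) = (fun=> 0).
    by apply/funext => r; exact: oriented_integral_itv1.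
  by rewrite oriented_integral0 addr0.
- apply: eq_bounded_measurable (bounded_measurableD
    (bounded_measurable_cst _ (f a c)) (bounded_measurable_indefinite ih)).
  by move=> s scd; rewrite [RHS]fE// !oriented_integral_itv1 !addr0.
Qed.

(** * The weighted inequality on the rectangle *)

Unset Implicit Arguments.

Theorem theorem4 (R : realType) (a b c d alpha1 alpha2 beta1 beta2 : R)
  (w : R -> R) (f : R -> R -> R)
  (ab : a < b) (cd : c < d)
  (alpha1_in : alpha1 \in `[a, b]) (alpha2_in : alpha2 \in `[a, b])
  (alpha12 : alpha1 < alpha2)
  (beta1_in : beta1 \in `[c, d]) (beta2_in : beta2 \in `[c, d])
  (beta12 : beta1 < beta2)
  (w_ge0 : forall u : R, u \in `[a, b] \/ u \in `[c, d] -> 0 <= w u)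
  (w_int : lebesgue_integrable (`[a, b] `|` `[c, d]) w)
  (m_alpha : 0 < mass w alpha1 alpha2) (m_beta : 0 < mass w beta1 beta2)
  (f_ac : caratheodory_ac a b c d f)
  (f_mixed : forall t s : R, t \in `[a, b] -> s \in `[c, d] ->
    mixed_derivable a b c d f t s)
  (f_bounded : (mixed_sup_norm a b c d f < +oo)%E) :
  forall x y : R, x \in `[a, b] -> y \in `[c, d] ->
  ((`| f x y
       - ((mass w alpha1 alpha2)^-1
            * (\oint[alpha1, alpha2]_t (w t * f t y))
          + (mass w beta1 beta2)^-1
            * (\oint[beta1, beta2]_s (w s * f x s)))
       + (mass w alpha1 alpha2 * mass w beta1 beta2)^-1
         * (\oint[alpha1, alpha2]_t \oint[beta1, beta2]_s
              (w t * w s * f t s)) |)%:E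
   <= (moment w alpha1 alpha2 x * moment w beta1 beta2 y
        / (mass w alpha1 alpha2 * mass w beta1 beta2))%:E
      * mixed_sup_norm a b c d f)%E.
Proof.
move=> x y xab ycd.
have iw1 : lebesgue_integrable `[a, b] w.
  by apply: integrableS w_int => //; exact: measurableU.
have iw2 : lebesgue_integrable `[c, d] w.
  by apply: integrableS w_int => //; exact: measurableU.
have w1_ge0 u : u \in `[a, b] -> 0 <= w u by move=> uab; apply: w_ge0; left.
have w2_ge0 u : u \in `[c, d] -> 0 <= w u by move=> ucd; apply: w_ge0; right.
have sub1 : `[alpha1, alpha2] `<=` `[a, b].
  apply: subset_itvScc; rewrite bnd_simp.
    by move: alpha1_in; rewrite in_itv => /andP[].
  by move: alpha2_in; rewrite in_itv => /andP[].
have sub2 : `[beta1, beta2] `<=` `[c, d].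
  apply: subset_itvScc; rewrite bnd_simp.
    by move: beta1_in; rewrite in_itv => /andP[].
  by move: beta2_in; rewrite in_itv => /andP[].
have iwI1 : lebesgue_integrable `[alpha1, alpha2] w by exact: integrableS iw1.
have iwI2 : lebesgue_integrable `[beta1, beta2] w by exact: integrableS iw2.
have aab : a \in `[a, b] by rewrite in_itv/= lexx ltW.
have ccd : c \in `[c, d] by rewrite in_itv/= lexx ltW.
have norm_le t s : t \in `]a, b[ -> s \in `]c, d[ ->
    (`|mixed_derive a b c d f t s|%:E <= mixed_sup_norm a b c d f)%E.
  by move=> tab scd; apply: ereal_sup_ubound; exists (t, s).
(* The midpoint of the open rectangle shows that the supremum is not taken over the empty set. It is
   thus nonnegative and, with [f_bounded], a real number [M]. *)
have norm_ge0 : (0 <= mixed_sup_norm a b c d f)%E.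
  apply: le_trans (norm_le _ _ (mid_in_itvoo ab) (mid_in_itvoo cd)).
  by rewrite lee_fin.
have norm_fin : mixed_sup_norm a b c d f \is a fin_num by rewrite ge0_fin_numE.
move: norm_le norm_ge0; rewrite -(fineK norm_fin).
set M := fine _; rewrite lee_fin => norm_le M_ge0.
have cross : forall x t y s, x \in `[a, b] -> t \in `[a, b] ->
    y \in `[c, d] -> s \in `[c, d] ->
    `|f x y - f t y - f x s + f t s| <= M * (`|x - t| * `|y - s|).
  by apply: cross_difference_le => // t s tab scd; rewrite -lee_fin norm_le.
have [bfc bfa] := caratheodory_ac_edges (ltW ab) (ltW cd) f_ac.
(* The difference of f at heights s and c is Lipschitz in t with constant M |s - c|, by [cross];
   adding back the edge function keeps the class. [bfx] is the same argument from the edge t = a. *)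
have bfy s : s \in `[c, d] -> bounded_measurable (`[a, b] : set (lebR R)) (f^~ s).
  move=> scd; have : bounded_measurable (`[a, b] : set (lebR R))
      (fun t => f t s - f t c).
    apply: (@lipschitz_bounded_measurable _ _ _ _ (M * `|s - c|)) => t t' tab t'ab.
    rewrite -mulrA [`|s - c| * _]mulrC; apply: le_trans (cross _ _ _ _ tab t'ab scd ccd).
    by rewrite le_eqVlt; apply/orP; left; apply/eqP; congr `| _ |; ring.
  move=> /(bounded_measurableD bfc); apply: eq_bounded_measurable => t _.
  by rewrite addrC subrK.
have bfx t : t \in `[a, b] -> bounded_measurable (`[c, d] : set (lebR R)) (f t).
  move=> tab; have : bounded_measurable (`[c, d] : set (lebR R))
      (fun s => f t s - f a s).
    apply: (@lipschitz_bounded_measurable _ _ _ _ (M * `|t - a|)) => s s' scd s'cd.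
    rewrite -mulrA; apply: le_trans (cross _ _ _ _ tab aab scd s'cd).
    by rewrite le_eqVlt; apply/orP; left; apply/eqP; congr `| _ |; ring.
  move=> /(bounded_measurableD bfa); apply: eq_bounded_measurable => s _.
  by rewrite addrC subrK.
have mI1 := measurable_itv_lebR `[alpha1, alpha2].
have mI2 := measurable_itv_lebR `[beta1, beta2].
have restr1 (v : R -> R) : bounded_measurable (`[a, b] : set (lebR R)) v ->
  bounded_measurable (`[alpha1, alpha2] : set (lebR R)) v.
  by apply: bounded_measurableS => //; exact: measurable_itv_lebR.
have restr2 (v : R -> R) : bounded_measurable (`[c, d] : set (lebR R)) v ->
  bounded_measurable (`[beta1, beta2] : set (lebR R)) v.
  by apply: bounded_measurableS => //; exact: measurable_itv_lebR.
(* Splitting f(t, s) into f(t, c) and the rest writes the inner integral as the mass times the edge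
   function plus [K t], and [K] is Lipschitz. *)
have bF : bounded_measurable (`[alpha1, alpha2] : set (lebR R))
    (fun t => \int[@leb1 R]_(s in `[beta1, beta2]) (w s * f t s)).
  pose K t := \int[@leb1 R]_(s in `[beta1, beta2]) (w s * (f t s - f t c)).
  have bK t : t \in `[a, b] ->
      bounded_measurable (`[beta1, beta2] : set (lebR R)) (fun s => f t s - f t c).
    move=> tab; apply: bounded_measurableB; last exact: bounded_measurable_cst.
    by apply: restr2; exact: bfx.
  have bKab : bounded_measurable (`[a, b] : set (lebR R)) K.
    (* [K t - K t'] integrates w against a cross difference with corners (t, s) and (t', c), which
       is at most M |t - t'| |s - c|; here |s - c| is at most d - c, and the weight contributes its
       mass. *)
    apply: (@lipschitz_bounded_measurable _ _ _ _ (M * (d - c) * mass w beta1 beta2)).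
    move=> t t' tab t'ab; rewrite /K -RintegralB//; [|exact: integrable_weighted (bK _ _)..].
    under eq_Rintegral do rewrite -mulrBr.
    apply: le_trans (@le_weighted_Rintegral _ _ _ (@leb1 R) _ w _
      (fun=> M * (d - c) * `|t - t'|) mI2 iwI2 _ _ _ _) _.
    + by move=> u /sub2; exact: w2_ge0.
    + by apply: bounded_measurableB; exact: bK.
    + exact: bounded_measurable_cst.
    + move=> s /sub2 scd.
      rewrite (_ : _ - _ = f t s - f t' s - f t c + f t' c); last by ring.
      apply: le_trans (cross _ _ _ _ tab t'ab scd ccd) _.
      rewrite -mulrA [`|t - t'| * _]mulrC ler_wpM2l// ler_wpM2r//.
      move: scd; rewrite /= in_itv/= => /andP[cs sd].
      by rewrite ger0_norm ?subr_ge0// lerD2r.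
    + by rewrite RintegralZr// /mass /oriented_integral (ltW beta12) mulrC mulrAC.
  have := bounded_measurableD (bounded_measurableZ (mass w beta1 beta2) bfc) bKab.
  move=> /restr1; apply: eq_bounded_measurable => t /sub1 tab.
  rewrite /K /mass /oriented_integral (ltW beta12) -RintegralZr// -RintegralD//.
  - by apply: eq_Rintegral => s _; ring.
  - exact: (integrable_weighted mI2 iwI2 (bounded_measurable_cst _ _)).
  - exact: (integrable_weighted mI2 iwI2 (bK _ tab)).
have main := @weighted_cross_difference_le _ _ _ _ R (@leb1 R) (@leb1 R)
  `[alpha1, alpha2] `[beta1, beta2] w (f^~ y) (fun t => `|x - t|)
  w (f x) (fun s => `|y - s|) f (f x y) M mI1 mI2 iwI1 iwI2
  (fun u uI => w1_ge0 u (sub1 u uI)) (fun u uI => w2_ge0 u (sub2 u uI))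
  (restr1 _ (bfy _ ycd)) (bounded_measurable_dist _ _ _)
  (restr2 _ (bfx _ xab)) (bounded_measurable_dist _ _ _)
  (fun t tI => restr2 _ (bfx _ (sub1 t tI))) bF
  (fun t s tI sI => cross _ _ _ _ xab (sub1 t tI) ycd (sub2 s sI)).
have A_le := le_moment iw1 w1_ge0 alpha1_in alpha2_in xab.
have B_le := le_moment iw2 w2_ge0 beta1_in beta2_in ycd.
(* Nonnegativity of both smaller factors allows [A_le] and [B_le] to be multiplied. *)
have A_ge0 : 0 <= \int[@leb1 R]_(u in `[alpha1, alpha2]) (w u * `|x - u|).
  by apply: Rintegral_ge0 => u /sub1 uab; rewrite mulr_ge0// w1_ge0.
have B_ge0 : 0 <= \int[@leb1 R]_(u in `[beta1, beta2]) (w u * `|y - u|).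
  by apply: Rintegral_ge0 => u /sub2 ucd; rewrite mulr_ge0// w2_ge0.
have inner t : t \in `[alpha1, alpha2] ->
    \oint[beta1, beta2]_s (w t * w s * f t s) =
    w t * \int[@leb1 R]_(s in `[beta1, beta2]) (w s * f t s).
  move=> /sub1 tab; rewrite (oriented_integralE _ (ltW beta12)) -RintegralZl//.
    by apply: eq_Rintegral => s _; rewrite mulrA.
  exact: (integrable_weighted mI2 iwI2 (restr2 _ (bfx _ tab))).
have outer : \oint[alpha1, alpha2]_t \oint[beta1, beta2]_s (w t * w s * f t s) =
    \int[@leb1 R]_(t in `[alpha1, alpha2])
      (w t * \int[@leb1 R]_(s in `[beta1, beta2]) (w s * f t s)).
  rewrite (oriented_integralE _ (ltW alpha12)).
  by apply: eq_Rintegral => t /[1!inE] /inner.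
rewrite -EFinM lee_fin outer (oriented_integralE _ (ltW alpha12)).
rewrite (oriented_integralE _ (ltW beta12)).
move: m_alpha m_beta main; rewrite /mass (oriented_integralE _ (ltW alpha12)).
rewrite (oriented_integralE _ (ltW beta12)).
set m1 := \int[@leb1 R]_(u in `[alpha1, alpha2]) w u.
set m2 := \int[@leb1 R]_(u in `[beta1, beta2]) w u => m1_gt0 m2_gt0 main.
have m12_gt0 : 0 < m1 * m2 by rewrite mulr_gt0.
(* The positive product of the masses is cleared from the right and then moved inside the absolute
   value on the left, where the expression becomes the one bounded by [main]. *)
rewrite [X in _ <= X]mulrAC ler_pdivlMr// [X in _ <= X]mulrC.
apply: le_trans (le_trans main _); last by rewrite ler_wpM2l// ler_pM.
have scale z : `|z| * (m1 * m2) = `|z * (m1 * m2)|.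
  by rewrite normrM (gtr0_norm m12_gt0).
rewrite scale le_eqVlt; apply/orP; left; apply/eqP; congr `| _ |.
by field; rewrite !gt_eqF.
Qed.
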